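(* Let $\theta\in(0,1)$, let $(X,T)$ be as in the context (in particular $X$ is geometric with parameter $\theta$, $T$ takes values in $\{0,1,\dots,G-1\}$, and $X$ and $T$ are independent under $\tilde P_\theta$). For $x\in\mathbb N_0$ put ${}_TN(x):=N(x)-N(x\wedge T)$ and $${}_TA(x,\theta):=\theta\sum_{k=1}^{x}{}_TY(k-1).$$ Then the process $\{{}_TN(x)-{}_TA(x,\theta):x\in\mathbb N_0\}$ is a martingale with respect to the filtration $\{{}_T\mathcal G_x:x\in\mathbb N_0\}$ and the probability measure $\tilde P_\theta^{\mathbb T}$ on $\mathcal G$ defined by $\tilde P_\theta^{\mathbb T}(\mathbb G):=\tilde P_\theta(\mathbb G\cap\mathbb T)/\tilde P_\theta(\mathbb T)$ for $\mathbb G\in\mathcal G$.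
   Context: $\mathbb N=\{1,2,\dots\}$, $\mathbb N_0=\{0,1,2,\dots\}$, $a\wedge b=\min(a,b)$, and $G\in\mathbb N$ is fixed. $\Omega=\{\omega_1,\omega_2,\dots\}$ is countable, $\mathcal G$ is its power set, and $(X,T)'$ is defined on $(\Omega,\mathcal G,\tilde P_\theta)$, where each $\omega$ corresponds to exactly one pair $(X,T)(\omega)\in\mathbb N\times\{0,1,\dots,G-1\}$ (i.e. $\omega\mapsto (X,T)(\omega)$ is a bijection onto this set). Under $\tilde P_\theta$, $\tilde P_\theta(X=x)=\theta(1-\theta)^{x-1}$ for $x\in\mathbb N$, and $X$ and $T$ are independent; the distribution of $T$ is otherwise arbitrary. Notation: $N(x):=\mathbf 1_{\{X\le x\}}$ and $Y(x):=\mathbf 1_{\{X\ge x+1\}}$ for $x\in\mathbb N_0$; ${}_TY(x):=Y(x)\mathbf 1_{\{x\ge T\}}=\mathbf 1_{\{X-1\ge x\ge T\}}$; $\mathbb T:=\{X\ge T+1\}$. Filtrations: $\mathcal G_x:=\sigma\{N(k),\mathbf 1_{\{T\le t\}}:1\le k\le x,\ 0\le t\le G-1\}$ for $x\in\mathbb N_0$ (so $\mathcal G_0=\sigma(T)$). $T$ is a stopping time for $\{\mathcal G_x\}$, and $\mathcal G_T:=\{\mathbb G\subseteq\Omega:\mathbb G\cap\{T\le x\}\in\mathcal G_x\ \forall x\in\mathbb N_0\}$. Finally ${}_T\mathcal G_x:=\mathcal G_x\vee\mathcal G_T$ is the smallest $\sigma$-field containing both $\mathcal G_x$ and $\mathcal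 G_T$. *)

(* Defs.v *)
(* MathComp-Analysis *)
From HB Require Import structures.
From mathcomp Require Import all_boot all_order all_algebra.
From mathcomp Require Import all_classical all_reals all_analysis.

Set Implicit Arguments.
Unset Strict Implicit.
Unset Printing Implicit Defensive.

Import Order.TTheory GRing.Theory Num.Theory.
Import numFieldNormedType.Exports.

Local Open Scope classical_set_scope.
Local Open Scope ring_scope.

Section generated_sigma_fields.
Context d (Omega : measurableType d) (R : realType).

Definition sigma_generated (F : set (Omega -> R)) : set_system Omega :=
  <<s \bigcup_(f in F) preimage_set_system setT f measurable >>.

(* For a sub-sigma-field H of the ambient one. *)
Definition measurable_wrt (H : set_system Omega) (f : Omega -> R) : Prop :=
  preimage_set_system setT f measurable `<=` H.

Definition sigma_join (H K : set_system Omega) : set_system Omega :=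
  <<s H `|` K >>.

Definition stopped_sigma (H : nat -> set_system Omega) (tau : Omega -> nat) :
    set_system Omega :=
  [set A | forall x, H x (A `&` [set w | (tau w <= x)%N])].

Definition filtration (H : nat -> set_system Omega) : Prop :=
  [/\ forall x, sigma_algebra setT (H x),
      forall x, H x `<=` measurable &
      forall x y, (x <= y)%N -> H x `<=` H y].

End generated_sigma_fields.

Section martingales.
Context d (Omega : measurableType d) (R : realType).
Variable Q : {measure set Omega -> \bar R}.

(* Z is a version of the conditional expectation of the integrable f given H. *)
Definition is_cond_expectation (H : set_system Omega) (f Z : Omega -> R) :
    Prop :=
  [/\ measurable_wrt H Z,
      Q.-integrable setT (EFin \o Z) &
      forall A, H A ->
        (\int[Q]_(w in A) (Z w)%:E = \int[Q]_(w in A) (f w)%:E)%E].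

Definition martingale (H : nat -> set_system Omega) (M : nat -> Omega -> R) :
    Prop :=
  [/\ filtration H,
      forall x, measurable_wrt (H x) (M x),
      forall x, Q.-integrable setT (EFin \o M x) &
      forall x y, (x <= y)%N -> is_cond_expectation (H x) (M y) (M x)].

End martingales.

(* B |-> P (B | A); it has total mass 1 only when P A != 0 (it vanishes
   identically otherwise). *)
Definition cond_prob d (Omega : measurableType d) (R : realType)
    (P : probability Omega R) (A : set Omega) (mA : measurable A) :
    set Omega -> \bar R :=
  fun B => (P (B `&` A) / P A)%E.

Section cond_prob_measure.
Context d (Omega : measurableType d) (R : realType).
Variables (P : probability Omega R) (A : set Omega) (mA : measurable A).

Local Notation PA := (cond_prob P mA).

Let cond_prob0 : PA set0 = 0%E.
Proof. by rewrite /cond_prob set0I measure0 mul0e. Qed.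

Let cond_prob_ge0 B : (0 <= PA B)%E.
Proof. by rewrite /cond_prob mule_ge0// inve_ge0. Qed.

Let cond_prob_sigma_additive : semi_sigma_additive PA.
Proof.
move=> F mF tF mU.
have [PA0|PA0] := eqVneq (P A) 0%E.
  have PA_eq0 B : measurable B -> PA B = 0%E.
    move=> mB; rewrite /cond_prob (_ : P (B `&` A) = 0%E) ?mul0e//.
    by apply: (subset_measure0 _ mA _ PA0) => //; exact: measurableI.
  rewrite PA_eq0// (_ : (fun _ => _) = cst 0%E); first exact: cvg_cst.
  by apply/funext => n; rewrite big1// => i _; rewrite PA_eq0.
have PAf : P A \is a fin_num by exact: fin_num_measure.
have rP : 0 <= (fine (P A))^-1 by rewrite invr_ge0 fine_ge0.
have PAE B : PA B = mscale (NngNum rP) (mrestr P mA) B.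
  rewrite /cond_prob /mscale /mrestr /= muleC; congr (_ * _)%E.
  by rewrite -{1}(fineK PAf) inver ifF//; apply/negbTE; rewrite fine_eq0.
rewrite PAE (_ : (fun n => _) =
    fun n => (\sum_(0 <= i < n) mscale (NngNum rP) (mrestr P mA) (F i))%E).
  exact: measure_semi_sigma_additive.
by apply/funext => n; apply: eq_bigr => i _; rewrite PAE.
Qed.

HB.instance Definition _ := isMeasure.Build _ _ _ PA
  cond_prob0 cond_prob_ge0 cond_prob_sigma_additive.

End cond_prob_measure.

Definition independent_nat d (Omega : measurableType d) (R : realType)
    (P : probability Omega R) (X T : Omega -> nat) : Prop :=
  forall A B : set nat,
    (P (X @^-1` A `&` T @^-1` B) = P (X @^-1` A) * P (T @^-1` B))%E.

Definition geometric_law d (Omega : measurableType d) (R : realType)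
    (P : probability Omega R) (theta : R) (X : Omega -> nat) : Prop :=
  forall x, (1 <= x)%N ->
    P [set w | X w = x] = (theta * (1 - theta) ^+ (x - 1))%:E.

Section truncated_counting_process.
Context d (Omega : measurableType d) (R : realType).
Variables (G : nat) (X T : Omega -> nat).

Definition count_proc (x : nat) : Omega -> R := \1_[set w | (X w <= x)%N].

Definition risk_proc (x : nat) : Omega -> R := \1_[set w | (x + 1 <= X w)%N].

Definition trunc_risk_proc (x : nat) : Omega -> R :=
  fun w => risk_proc x w * \1_[set w | (T w <= x)%N] w.

Definition trunc_count_proc (x : nat) : Omega -> R :=
  fun w => count_proc x w - count_proc (minn x (T w)) w.

Definition trunc_compensator (theta : R) (x : nat) : Omega -> R :=
  fun w => theta * \sum_(1 <= k < x.+1) trunc_risk_proc (k - 1) w.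

Definition observed : set Omega := [set w | (T w + 1 <= X w)%N].

Definition filt (x : nat) : set_system Omega :=
  sigma_generated
    ([set count_proc k | k in [set k | (1 <= k <= x)%N]] `|`
     [set (\1_[set w | (T w <= t)%N] : Omega -> R) |
        t in [set t | (t <= G - 1)%N]]).

Definition trunc_filt (x : nat) : set_system Omega :=
  sigma_join (filt x) (stopped_sigma filt T).

End truncated_counting_process.
Arguments count_proc {d Omega} R X x _.
Arguments risk_proc {d Omega} R X x _.
Arguments trunc_risk_proc {d Omega} R X T x _.
Arguments trunc_count_proc {d Omega} R X T x _.
Arguments filt {d Omega} R G X T x _.
Arguments trunc_filt {d Omega} R G X T x _.

(* Main.v *)
(* On a countable Omega everything reduces to partitions: filt x consists of the
   sets saturated for (min(X, x + 1), T), and the sets of trunc_filt x are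
   saturated for (min(X, max(x, T) + 1), T). Between x and x + 1 the process
   moves by 1_{T <= x, X = x + 1} - theta 1_{T <= x < X}, which vanishes off
   {T <= x < X}; on that event, which lies inside {X >= T + 1}, a set of
   trunc_filt x depends on T alone, so independence and the memoryless identity
   P(X = x + 1) = theta P(X > x) make the increment integrate to 0 over it. *)
Require Import Defs.
From mathcomp Require Import all_boot all_order all_algebra.
From mathcomp Require Import all_classical all_reals all_analysis.
From mathcomp Require Import ring zify.
Import Order.TTheory GRing.Theory Num.Theory.
Import numFieldNormedType.Exports.
Local Open Scope classical_set_scope.
Local Open Scope ring_scope.

(** * Sigma-algebras and saturated sets *)

Section sigma_algebra_closure.
Context {U : Type} {S : set_system U} (sS : sigma_algebra setT S).

Lemma sigma_algebra_setC A : S A -> S (~` A).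
Proof. by case: sS => _ SC _ /SC; rewrite setTD. Qed.

Lemma sigma_algebra_setT : S setT.
Proof. by case: sS => S0 _ _; rewrite -setC0; exact: sigma_algebra_setC. Qed.

Lemma sigma_algebra_setU A B : S A -> S B -> S (A `|` B).
Proof.
case: sS => S0 _ Sbig SA SB; rewrite -bigcup2E; apply: Sbig.
by case=> [|[|n]].
Qed.

Lemma sigma_algebra_setI A B : S A -> S B -> S (A `&` B).
Proof.
move=> SA SB; rewrite -[A `&` B]setCK setCI.
by apply/sigma_algebra_setC/sigma_algebra_setU; exact: sigma_algebra_setC.
Qed.

Lemma sigma_algebra_setD A B : S A -> S B -> S (A `\` B).
Proof.
by move=> SA SB; apply: sigma_algebra_setI => //; exact: sigma_algebra_setC.
Qed.

End sigma_algebra_closure.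

(** The unions of fibres of [f]. When [f] has countably many values this is the sigma-algebra
    generated by its fibres, put in a form that turns membership into a pointwise test. *)
Definition saturated {U V : Type} (f : U -> V) : set_system U :=
  [set A | forall w w', f w = f w' -> A w -> A w'].

Lemma sigma_algebra_saturated {U V : Type} (f : U -> V) :
  sigma_algebra setT (saturated f).
Proof.
split => //= [A fA w w' ff' [_ nAw]|A fA w w' ff' [n _ Anw]].
  by split=> // /fA nAw'; apply: nAw; apply: nAw'.
by exists n => //; apply: fA ff' Anw.
Qed.

Lemma sub_saturated {U V W : Type} (f : U -> V) (g : U -> W) :
  (forall w w', g w = g w' -> f w = f w') -> saturated f `<=` saturated g.
Proof. by move=> gf A fA w w' /gf; exact: fA. Qed.

Lemma saturated_subset {U : Type} {V : countType} {S : set_system U}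
    (f : U -> V) :
  sigma_algebra setT S -> (forall v, S (f @^-1` [set v])) ->
  saturated f `<=` S.
Proof.
move=> sS Sf A fA.
(* A saturated set is the union of the fibres that it meets. Indexing them by codes makes the union
   countable; codes of no value and fibres that miss [A] contribute the empty set. *)
have -> : A = \bigcup_n (if (pickle_inv n : option V) is Some v
    then if `[< exists2 w, A w & f w = v >] then f @^-1` [set v] else set0
    else set0).
  apply/seteqP; split=> [w Aw|w [n _]].
    exists (pickle (f w)) => //; rewrite pickleK_inv.
    by case: asboolP => // -[]; exists w.
  case: (pickle_inv n) => // v; case: asboolP => // -[w' Aw' <-] /= ww'.
  by apply: fA Aw'.
have [S0 _ Sbig] := sS; apply: Sbig => n.
by case: (pickle_inv n) => // v; case: asboolP.
Qed.

Section saturated_functions.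
Context d (Omega : measurableType d) (R : realType).

Lemma sigma_generated_saturated {V : Type} (f : Omega -> V)
    (F : set (Omega -> R)) :
  (forall g, F g -> forall w w', f w = f w' -> g w = g w') ->
  sigma_generated F `<=` saturated f.
Proof.
move=> Ff; apply: smallest_sub; first exact: sigma_algebra_saturated.
move=> _ [g Fg [B _ <-]] w w' ff' [_ Bgw]; split=> //.
by rewrite /preimage /= -(Ff _ Fg _ _ ff').
Qed.

Lemma measurable_wrt_saturated {V : Type} (f : Omega -> V) (g : Omega -> R) :
  (forall w w', f w = f w' -> g w = g w') -> measurable_wrt (saturated f) g.
Proof.
move=> fg _ [B _ <-] w w' ff' [_ Bgw]; split=> //.
by rewrite /preimage /= -(fg _ _ ff').
Qed.

Lemma sigma_generated_indic (F : set (Omega -> R)) (A : set Omega) :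
  F \1_A -> sigma_generated F A.
Proof.
move=> FA; apply: sub_sigma_algebra; exists \1_A => //.
exists [set 1] => //; rewrite setTI; apply/seteqP; split=> w /=.
  rewrite indicE; case: (boolP (w \in A)) => [/set_mem//|_] /= /eqP.
  by rewrite eq_sym oner_eq0.
by move=> Aw; rewrite indicE mem_set.
Qed.

End saturated_functions.

(** A set of [H x] stays in every later [H (x + n)], so the one-step identities over that set chain
    up to any later time. *)
Lemma martingale_of_steps d (Omega : measurableType d) (R : realType)
    (Q : {measure set Omega -> \bar R}) (H : nat -> set_system Omega)
    (M : nat -> Omega -> R) :
  filtration H -> (forall x, measurable_wrt (H x) (M x)) ->
  (forall x, Q.-integrable setT (EFin \o M x)) ->
  (forall x A, H x A ->
    \int[Q]_(w in A) (M x.+1 w)%:E = \int[Q]_(w in A) (M x w)%:E)%E ->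
  martingale Q H M.
Proof.
move=> fH adM intM stepM; split=> // x y xy; split=> // A HxA.
rewrite -(subnKC xy); elim: (y - x)%N => [|n IHn]; first by rewrite addn0.
rewrite addnS stepM //; case: fH => _ _ mono.
by apply: mono HxA; rewrite leq_addr.
Qed.

(** * Finiteness of the conditional measure, and the geometric tail *)

Lemma cond_prob_fin_num d (Omega : measurableType d) (R : realType)
    (P : probability Omega R) (A : set Omega) (mA : measurable A) B :
  measurable B -> cond_prob P mA B \is a fin_num.
Proof.
move=> mB; rewrite /cond_prob; have mBA := measurableI _ _ mB mA.
(* If [P A = 0] the numerator vanishes as well, and 0 times the inverse is 0. *)
have [PA0|PA0] := eqVneq (P A) 0%E.
  by rewrite (subset_measure0 mBA mA (@subIsetr _ _ _) PA0) mul0e.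
rewrite fin_numM ?fin_num_measure // fin_numV // gt_eqF //.
by rewrite ltNye_eq fin_num_measure.
Qed.

Lemma integrable_indic_cond_prob d (Omega : measurableType d) (R : realType)
    (P : probability Omega R) (A : set Omega) (mA : measurable A) B :
  measurable B ->
  (cond_prob P mA).-integrable setT (EFin \o (\1_B : Omega -> R)).
Proof.
move=> mB; apply: measurable_bounded_integrable => //.
- by rewrite -ge0_fin_numE //; exact: cond_prob_fin_num.
- exists 1; split=> // y y1 w _ /=; apply: le_trans (ltW y1).
  by rewrite indicE; case: (w \in B); rewrite /= ?normr0 ?normr1.
Qed.

(** Induction on [x]: removing the atom [X = x + 1] from the event [X > x] leaves [X > x + 1], of
    mass [(1 - theta)^x - theta (1 - theta)^x]. The base case is [X >= 1]. *)
Lemma geometric_tail d (Omega : measurableType d) (R : realType)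
    (P : probability Omega R) (theta : R) (X : Omega -> nat) :
  (forall x, measurable [set w | X w = x]) ->
  (forall w, (1 <= X w)%N) -> geometric_law P theta X ->
  forall x, P [set w | (x + 1 <= X w)%N] = ((1 - theta) ^+ x)%:E.
Proof.
move=> mX X1 geoX.
have mXge x : measurable [set w | (x + 1 <= X w)%N].
  rewrite (_ : [set _ | _] = ~` \bigcup_(i < x.+1) [set w | X w = i]).
    by apply/measurableC/bigcup_measurable => i _; exact: mX.
  apply/seteqP; split=> [w /= xX [i /= ix Xi]|w /= nX]; first lia.
  by rewrite leqNgt; apply/negP => Xx; apply: nX; exists (X w) => //=; lia.
elim=> [|x IHx].
  rewrite expr0 -(probability_setT P); congr (P _).
  by apply/seteqP; split=> // w _ /=; exact: X1.
have : P [set w | (x + 1 <= X w)%N] =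
    (P [set w | X w = (x + 1)%N] + P [set w | (x.+1 + 1 <= X w)%N])%E.
  rewrite -measureU //.
    by congr (P _); apply/seteqP; split=> w /=; [lia|case; lia].
  by rewrite -subset0 => w /= []; lia.
rewrite IHx geoX ?addn1 // subn1 /=.
rewrite -[P [set w | (_ <= X w)%N]]fineK; last first.
  by rewrite -addn1; exact: fin_num_measure.
rewrite -EFinD => -[xE]; congr EFin.
by rewrite exprS mulrBl mul1r [X in X - _]xE; ring.
Qed.

Lemma sigma_algebra_nat_fibre {U : Type} {S : set_system U} (f : U -> nat) :
  sigma_algebra setT S -> (forall n, S [set w | (f w <= n)%N]) ->
  forall n, S [set w | f w = n].
Proof.
move=> sS Sf [|n].
  rewrite (_ : mkset _ = [set w | (f w <= 0)%N]) //.
  by apply/seteqP; split=> w /=; lia.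
rewrite (_ : mkset _ = [set w | (f w <= n.+1)%N] `\` [set w | (f w <= n)%N]).
  exact: sigma_algebra_setD.
by apply/seteqP; split=> w /=; [lia|case; lia].
Qed.

Lemma indic_pred {U : Type} {R : realType} (p : pred U) w :
  \1_[set w | p w] w = (p w)%:R :> R.
Proof.
rewrite indicE; congr ((nat_of_bool _)%:R).
by apply/idP/idP => [/set_mem//|pw]; exact: mem_set.
Qed.

(** * The two filtrations in terms of saturated sets *)

Section truncation.
Context d (Omega : measurableType d) (R : realType).
Context {G : nat} {X T : Omega -> nat}.
Hypothesis X_ge1 : forall w, (1 <= X w)%N.
Hypothesis T_leG : forall w, (T w <= G - 1)%N.

(** What is known at time [x]: the cap [x + 1] stands for [X > x], so [X] is visible only once it is
    at most [x]. *)
Definition info x (w : Omega) : nat * nat := (minn (X w) x.+1, T w).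

(** Joining the stopped sigma-field reveals [X] up to time [T], so the horizon [x] becomes
    [max(x, T)]. *)
Definition trunc_info x (w : Omega) : nat * nat :=
  (minn (X w) (maxn x (T w)).+1, T w).

(** The generators are constant on the fibres of [info x]; conversely, each fibre is cut out by
    sublevel sets of [T] and of [min(X, x + 1)], which are generating events or trivial. *)
Lemma filt_saturated x : filt R G X T x = saturated (info x).
Proof.
have sF : sigma_algebra setT (filt R G X T x) by exact: smallest_sigma_algebra.
apply/seteqP; split.
  apply: sigma_generated_saturated => g.
  move=> [[k /= kx <-]|[t /= _ <-]] w w' [Xww' Tww'].
    by rewrite /count_proc !indic_pred; congr (_%:R); lia.
  by rewrite !indic_pred Tww'.
have ST t : filt R G X T x [set w | (T w <= t)%N].
  have [tG|Gt] := leqP t (G - 1).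
    by apply: sigma_generated_indic; right; exists t.
  rewrite (_ : mkset _ = setT); first exact: sigma_algebra_setT.
  by apply/seteqP; split=> w //= _; have := T_leG w; lia.
have SX i : filt R G X T x [set w | (minn (X w) x.+1 <= i)%N].
  have [xi|ix] := leqP x.+1 i.
    rewrite (_ : mkset _ = setT); first exact: sigma_algebra_setT.
    by apply/seteqP; split=> w //= _; lia.
  rewrite (_ : mkset _ = [set w | (X w <= i)%N]); last first.
    by apply/seteqP; split=> w /=; lia.
  (* The generators start at [k = 1]; for [i = 0] the event is empty since [X >= 1]. *)
  case: i ix => [|i] ix.
    rewrite (_ : mkset _ = set0); first by case: sF.
    by apply/seteqP; split=> w //=; have := X_ge1 w; lia.
  by apply: sigma_generated_indic; left; exists i.+1.
apply: saturated_subset => // -[i t].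
rewrite (_ : _ @^-1` _ =
    [set w | minn (X w) x.+1 = i] `&` [set w | T w = t]); last first.
  by apply/seteqP; split=> w /= [wi wt]; [split|congr (_, _)].
by apply: (sigma_algebra_setI sF); exact: (sigma_algebra_nat_fibre _ sF).
Qed.

Lemma filt_mono x y : (x <= y)%N -> filt R G X T x `<=` filt R G X T y.
Proof.
by move=> xy; rewrite !filt_saturated; apply: sub_saturated => w w' [Xww' Tww'];
  congr (_, _); lia.
Qed.

Lemma trunc_filt_sub_saturated x :
  trunc_filt R G X T x `<=` saturated (trunc_info x).
Proof.
apply: smallest_sub; first exact: sigma_algebra_saturated.
move=> A [|stA].
  rewrite filt_saturated; apply: sub_saturated => w w' [Xww' Tww'].
  by congr (_, _) => //; rewrite Tww' in Xww' *; lia.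
(* The stopping condition is tested at time [T w], where [T <= T w] holds at both points and equal
   [trunc_info x] forces equal [info (T w)]. *)
move=> w w' [Xww' Tww'] Aw; have := stA (T w); rewrite filt_saturated => satA.
have [] // := satA w w' _ (conj Aw (leqnn _)).
by congr (_, _) => //; rewrite -Tww' in Xww'; lia.
Qed.

Lemma filtration_trunc_filt :
  (forall A : set Omega, measurable A) -> filtration (trunc_filt R G X T).
Proof.
move=> mO; split=> [x|x A _|x y xy]; first exact: smallest_sigma_algebra.
  exact: mO.
apply: sub_smallest2r; first exact: smallest_sigma_algebra.
by apply: setSU; exact: filt_mono.
Qed.

(** * One-step increments of the compensated process *)

Variable theta : R.

Let M x w := trunc_count_proc R X T x w - trunc_compensator X T theta x w.

Let jump x := [set w | (T w <= x)%N && (X w == x.+1)].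

Let at_risk x := [set w | (T w <= x)%N && (x < X w)%N].

Lemma trunc_residual0 w : M 0 w = 0.
Proof.
rewrite /M /trunc_count_proc /trunc_compensator min0n subrr.
by rewrite big_geq // mulr0 subr0.
Qed.

Lemma trunc_residualS x w :
  M x.+1 w = M x w + (\1_(jump x) w - theta * \1_(at_risk x) w).
Proof.
rewrite /M /trunc_compensator big_nat_recr //= mulrDr.
have -> : trunc_risk_proc R X T (x.+1 - 1) w = \1_(at_risk x) w.
  rewrite /trunc_risk_proc /risk_proc !indic_pred subn1 addn1 /=.
  by rewrite -natrM mulnb andbC.
have -> : trunc_count_proc R X T x.+1 w =
    trunc_count_proc R X T x w + \1_(jump x) w.
  rewrite /trunc_count_proc /count_proc !indic_pred.
  (* If [T w <= x], the subtracted count is frozen at time [T w] and only [count_proc] moves; if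
     [T w > x], both sides are 0. *)
  have [Tx|xT] := leqP (T w) x.
    have -> : minn x.+1 (T w) = T w by lia.
    have -> : (X w <= x.+1)%N = ((X w <= x)%N + (X w == x.+1))%N :> nat by lia.
    by rewrite natrD; ring.
  have -> : minn x.+1 (T w) = x.+1 by lia.
  by rewrite /= addr0 !subrr.
ring.
Qed.

Lemma measurable_trunc_residual x : measurable_wrt (trunc_filt R G X T x) (M x).
Proof.
(* The process is already adapted to the smaller [filt], where it suffices to be constant on the
   fibres of [info x]. *)
suff : measurable_wrt (filt R G X T x) (M x).
  by move=> mM A /mM FA; apply: sub_sigma_algebra; left.
rewrite filt_saturated; apply: measurable_wrt_saturated.
elim: x => [|x IHx] w w' [Xww' Tww']; first by rewrite !trunc_residual0.
rewrite !trunc_residualS !indic_pred Tww' (IHx w w'); last by congr (_, _); lia.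
by congr (_ + (_%:R - _ * _%:R)); lia.
Qed.

(** * Integration under the conditional measure *)

Context {P : probability Omega R}.
Hypothesis mO : forall A : set Omega, measurable A.
Local Notation Q := (cond_prob P (mO (observed X T))).

Lemma integrable_trunc_residual x : Q.-integrable setT (EFin \o M x).
Proof.
elim: x => [|x IHx].
  rewrite (_ : _ \o _ = cst 0%E); first exact: integrable0.
  by apply/funext => w; rewrite /= trunc_residual0.
rewrite (_ : _ \o _ = (EFin \o M x) \+
    ((EFin \o \1_(jump x)) \- (fun w => theta%:E * (\1_(at_risk x) w)%:E)))%E.
  apply: integrableD => //; apply: integrableB => //.
    exact: integrable_indic_cond_prob.
  by apply: integrableZl => //; exact: integrable_indic_cond_prob.
by apply/funext => w; rewrite /= trunc_residualS.
Qed.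

Hypothesis geoX : geometric_law P theta X.
Hypothesis indXT : independent_nat P X T.

Lemma cond_prob_jump x A : trunc_filt R G X T x A ->
  (Q (jump x `&` A) = theta%:E * Q (at_risk x `&` A))%E.
Proof.
move=> /trunc_filt_sub_saturated satA.
rewrite /cond_prob muleA; congr (_ * _)%E.
(* The values of [T] taken in [A] while at risk. Where [T <= x < X], [trunc_info x] equals
   [(x + 1, T)], so belonging to [A] amounts to [T] lying in [C]. *)
pose C := [set t | (t <= x)%N /\ exists w, [/\ A w, T w = t & (x < X w)%N]].
(* Used with [B = {x + 1}] for the jump and [B = {n > x}] for the risk event; [observed] is absorbed
   because [T <= x < X]. *)
have cut B : B `<=` [set n | (x < n)%N] ->
    [set w | (T w <= x)%N /\ B (X w)] `&` A `&` observed X T =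
    X @^-1` B `&` T @^-1` C.
  move=> Bx; apply/seteqP; split=> w.
    move=> [[[Tx BX] Aw] _].
    by split=> //; split=> //; exists w; split=> //; exact: Bx.
  move=> [BX [Tx [w' [Aw' Tw' Xw']]]].
  have /= Xw := Bx _ BX; split; last by rewrite /observed /=; lia.
  by split=> //; apply: satA Aw'; rewrite /trunc_info Tw'; congr (_, _); lia.
have -> : jump x = [set w | (T w <= x)%N /\ [set x.+1] (X w)].
  apply/seteqP; split=> w /=; first by case/andP => ? /eqP.
  by case=> Tx Xx; apply/andP; rewrite Xx.
have -> : at_risk x = [set w | (T w <= x)%N /\ [set n | (x < n)%N] (X w)].
  by apply/seteqP; split=> w /= /andP.
rewrite !cut //; last by move=> _ ->; rewrite /= ltnSn.
(* Independence splits off the common factor [P (T in C)], leaving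
   [P (X = x + 1) = theta P (X > x)]. *)
rewrite !indXT muleA; congr (_ * _)%E.
have := @geometric_tail _ _ _ _ _ _ (fun=> mO _) X_ge1 geoX x.
rewrite (_ : mkset _ = X @^-1` [set n | (x < n)%N]) => [->|]; last first.
  by apply/seteqP; split=> w /=; rewrite addn1.
by have := geoX x.+1 isT; rewrite subn1 -EFinM.
Qed.

Lemma integral_trunc_residualS x A : trunc_filt R G X T x A ->
  (\int[Q]_(w in A) (M x.+1 w)%:E = \int[Q]_(w in A) (M x w)%:E)%E.
Proof.
move=> FA.
have intA f : Q.-integrable setT f -> Q.-integrable A f.
  by apply: integrableS => //; exact: mO.
have int1 B : Q.-integrable A (EFin \o (\1_B : Omega -> R)).
  by apply: intA; exact: integrable_indic_cond_prob.
have intM := intA _ (integrable_trunc_residual x).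
have intD : Q.-integrable A (fun w => theta%:E * (EFin \o \1_(at_risk x)) w)%E.
  exact: integrableZl.
under eq_integral do rewrite trunc_residualS EFinD.
rewrite integralD //; last exact: (integrableB (mO A) (int1 _) intD).
rewrite (integralB (mO A) (int1 _) intD) integralZl // !integral_indic //.
(* The two masses agree, and their extended-real difference is 0 because they are finite. *)
rewrite -[X in (_ - X)%E](cond_prob_jump _ _ FA) subee ?adde0 //.
exact/cond_prob_fin_num/mO.
Qed.

Lemma martingale_trunc_residual : martingale Q (trunc_filt R G X T) M.
Proof.
apply: martingale_of_steps.
- exact: filtration_trunc_filt.
- exact: measurable_trunc_residual.
- exact: integrable_trunc_residual.
- exact: integral_trunc_residualS.
Qed.

End truncation.

Theorem theorem1 (R : realType) (d : measure_display)
    (Omega : measurableType d) (P : probability Omega R)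
    (G : nat) (theta : R) (X T : Omega -> nat)
    (G_gt0 : (0 < G)%N)
    (Omega_countable : countable [set: Omega])
    (Omega_powerset : forall A : set Omega, measurable A)
    (XT_bij : set_bij [set: Omega]
       [set p : nat * nat | (1 <= p.1)%N /\ (p.2 <= G - 1)%N]
       (fun w => (X w, T w)))
    (theta_gt0 : 0 < theta) (theta_lt1 : theta < 1)
    (X_geometric : geometric_law P theta X)
    (XT_independent : independent_nat P X T) :
  let Q := cond_prob P (Omega_powerset (observed X T)) in
  Q [set: Omega] = 1%E /\
  martingale Q (trunc_filt R G X T)
    (fun x w => trunc_count_proc R X T x w - trunc_compensator X T theta x w).
Proof.
have [XT_fun _ _] := XT_bij.
have X_ge1 w : (1 <= X w)%N by have [] := XT_fun w I.
have T_leG w : (T w <= G - 1)%N by have [] := XT_fun w I.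
move=> Q; split; last exact: martingale_trunc_residual.
rewrite /Q /cond_prob setTI divee ?fin_num_measure // gt_eqF //.
(* Since [T <= G - 1], the event [X = G] lies inside [observed], and its geometric mass is
   positive. *)
apply: (@lt_le_trans _ _ (P [set w | X w = G])).
  by rewrite X_geometric // lte_fin mulr_gt0 // exprn_gt0 // subr_gt0.
apply: le_measure; rewrite ?inE // => w /= XG.
by rewrite /observed /= XG; have := T_leG w; lia.
Qed.
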